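(* Let $G$ be a countable discrete group with property A, and let $\alpha:H\to K$ be an isomorphism between two subgroups $H,K$ of $G$. Then the HNN extension $G*_\alpha$ has property A.
   Context: The HNN extension is $G*_\alpha=\langle G,t\mid tht^{-1}=\alpha(h)\text{ for all }h\in H\rangle$. Property A: a discrete metric space $(X,d)$ has property A if for all $R,\epsilon>0$ there exists a family $\{A_x\}_{x\in X}$ of finite, non-empty subsets of $X\times\mathbb{N}$ such that (i) for all $x,y\in X$ with $d(x,y)\le R$ we have $\frac{|A_x\triangle A_y|}{|A_x\cap A_y|}<\epsilon$; (ii) there exists $S$ such that for each $x\in X$, if $(y,n)\in A_x$ then $d(x,y)\le S$. Groups as metric spaces: a discrete metric space $X$ has bounded geometry if for all $r>0$ there is $N_r$ with $|B(x,r)|<N_r$ for all $x\in X$. Every countable discrete group $G$ admits a left-invariant metric ($d(hg,hg')=d(g,g')$) of bounded geometry, and any two such metrics are coarsely equivalent via the identity map. A countable discrete group is said to have property A if it has property A as a metric space with respect to some (equivalently, every) left-invariant bounded geometry metric. *)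

(* Defs.v *)
From HB Require Import structures.
From mathcomp Require Import all_boot all_order all_algebra finmap.
From mathcomp Require Import all_classical all_reals all_analysis.

Set Implicit Arguments.
Unset Strict Implicit.
Unset Printing Implicit Defensive.

Import Order.TTheory GRing.Theory Num.Theory.

Local Open Scope classical_set_scope.
Local Open Scope ring_scope.
Local Open Scope quotient_scope.

Definition bounded_geometry (R : realType) (X : metricType R) : Prop :=
  forall r : R, 0 < r -> exists N : nat, forall x : X,
    finite_set (ball x r) /\ (#|` fset_set (ball x r)| < N)%N.

(* The quotient of cardinals is infinite, hence not smaller than [eps], when
   the intersection is empty; since [x / 0 = 0] here, non-emptiness of the
   intersection has to be required explicitly. *)
Definition property_A (R : realType) (X : metricType R) : Prop :=
  forall r eps : R, 0 < r -> 0 < eps ->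
  exists A : X -> {fset X * nat},
    [/\ forall x, (A x != fset0)%fset,
        forall x y, mdist x y <= r ->
          (A x `&` A y != fset0)%fset /\
          #|` (A x `\` A y) `|` (A y `\` A x)|%fset%:R /
            #|` A x `&` A y|%fset%:R < eps
      & exists s : R, forall x y n, (y, n) \in A x -> mdist x y <= s].

Record is_metric (R : realType) (T : choiceType) (d : T -> T -> R) : Prop := {
  is_metric_xx : forall x, d x x = 0;
  is_metric_positivity : forall x y, d x y = 0 -> x = y;
  is_metric_sym : forall x y, d x y = d y x;
  is_metric_triangle : forall y x z, d x z <= d x y + d y z
}.

(* The type [T] seen as a metric space through the distance [d]. *)
Definition metric_by (R : realType) (T : choiceType) (d : T -> T -> R)
  (dm : is_metric d) : Type := T.

HB.instance Definition _ (R : realType) (T : choiceType) (d : T -> T -> R)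
  (dm : is_metric d) := Choice.on (metric_by dm).
HB.instance Definition _ (R : realType) (T : choiceType) (d : T -> T -> R)
  (dm : is_metric d) :=
  isMetric.Build R (metric_by dm) (is_metric_xx dm)
    (is_metric_positivity dm) (is_metric_sym dm) (is_metric_triangle dm).

Lemma mdist_metric_by (R : realType) (T : choiceType) (d : T -> T -> R)
  (dm : is_metric d) (x y : metric_by dm) : mdist x y = d x y.
Proof. by []. Qed.

Definition left_invariant (R : realType) (G : groupType) (d : G -> G -> R)
  : Prop := forall h g g' : G, d (h * g)%g (h * g')%g = d g g'.

Definition group_property_A (R : realType) (G : groupType) : Prop :=
  exists (d : G -> G -> R) (dm : is_metric d),
    [/\ left_invariant d,
        bounded_geometry (metric_by dm)
      & property_A (metric_by dm)].

(* A subgroup of a possibly infinite group is a [groupClosed] predicate.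
   An isomorphism between subgroups is a total function of which only the
   values on [H] matter. *)
Definition subgroup_isom (G : groupType) (H K : groupClosed G)
    (alpha : G -> G) : Prop :=
  {in H &, {morph alpha : x y / (x * y)%g}} /\
  set_bij [set` H] [set` K] alpha.

(* A letter is an element [inl g] of [G], or the stable letter
   [t = inr true], or its formal inverse [inr false]. *)
Definition hnn_word (G : groupType) : Type := seq (G + bool).

HB.instance Definition _ (G : groupType) := Choice.on (hnn_word G).

Section HNNExtension.
Variables (G : groupType) (H : {pred G}) (alpha : G -> G).

(* The presentation of [G] hidden in < G, t | ... > is its multiplication
   table: [hnn_one] and [hnn_mul]. [hnn_universal] below checks the result. *)
Inductive hnn_cong : hnn_word G -> hnn_word G -> Prop :=
| hnn_refl u : hnn_cong u u
| hnn_sym u v : hnn_cong u v -> hnn_cong v u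
| hnn_trans v u w : hnn_cong u v -> hnn_cong v w -> hnn_cong u w
| hnn_cat u u' v v' :
    hnn_cong u u' -> hnn_cong v v' -> hnn_cong (u ++ v) (u' ++ v')
| hnn_one : hnn_cong [:: inl 1%g] [::]
| hnn_mul g g' : hnn_cong [:: inl g; inl g'] [:: inl (g * g')%g]
| hnn_tV : hnn_cong [:: inr true; inr false] [::]
| hnn_Vt : hnn_cong [:: inr false; inr true] [::]
| hnn_conj h : h \in H ->
    hnn_cong [:: inr true; inl h; inr false] [:: inl (alpha h)].

Definition hnn_eq (u v : hnn_word G) : bool := `[< hnn_cong u v >].

Lemma hnn_eq_refl : reflexive hnn_eq.
Proof. by move=> u; apply/asboolP; exact: hnn_refl. Qed.

Lemma hnn_eq_sym : symmetric hnn_eq.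
Proof. by move=> u v; apply/asboolP/asboolP => /hnn_sym. Qed.

Lemma hnn_eq_trans : transitive hnn_eq.
Proof.
move=> v u w /asboolP uv /asboolP vw; apply/asboolP.
exact: hnn_trans uv vw.
Qed.

Canonical hnn_equiv := EquivRel hnn_eq hnn_eq_refl hnn_eq_sym hnn_eq_trans.

(* The HNN extension  < G, t | t h t^-1 = alpha h for all h in H >. *)
Definition hnn_extension : Type := {eq_quot hnn_eq}.

HB.instance Definition _ := Choice.on hnn_extension.
HB.instance Definition _ := Quotient.on hnn_extension.

Lemma hnn_piP (u v : hnn_word G) :
  \pi_hnn_extension u = \pi_hnn_extension v <-> hnn_cong u v.
Proof.
by split=> [/eqmodP/asboolP//|uv]; apply/eqmodP/asboolP.
Qed.

Definition hnn_letter_inv (a : G + bool) : G + bool :=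
  match a with inl g => inl g^-1%g | inr b => inr (~~ b) end.

Definition hnn_word_inv (u : hnn_word G) : hnn_word G :=
  rev (map hnn_letter_inv u).

Lemma hnn_word_mulV (u : hnn_word G) : hnn_cong (u ++ hnn_word_inv u) [::].
Proof.
elim: u => [|a u IH]; first exact: hnn_refl.
have -> : (a :: u) ++ hnn_word_inv (a :: u) =
          [:: a] ++ ((u ++ hnn_word_inv u) ++ [:: hnn_letter_inv a]).
  by rewrite /hnn_word_inv /= rev_cons -cats1 -catA.
apply: (hnn_trans (v := [:: a] ++ ([::] ++ [:: hnn_letter_inv a]))).
  by do 2?[apply: hnn_cat => //; try exact: hnn_refl].
case: a => [g|[]] /=; [|exact: hnn_tV|exact: hnn_Vt].
by apply: hnn_trans (hnn_mul _ _) _; rewrite mulgV; exact: hnn_one.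
Qed.

Lemma hnn_word_invK : involutive hnn_word_inv.
Proof.
move=> u; rewrite /hnn_word_inv map_rev revK -map_comp map_id_in//.
by move=> [g|b] _ /=; rewrite ?invgK ?negbK.
Qed.

Lemma hnn_word_Vmul (u : hnn_word G) : hnn_cong (hnn_word_inv u ++ u) [::].
Proof. by rewrite -{2}(hnn_word_invK u); exact: hnn_word_mulV. Qed.

Definition hnn_one_elt : hnn_extension := \pi_hnn_extension [::].
Definition hnn_mul_elt (x y : hnn_extension) : hnn_extension :=
  \pi_hnn_extension (repr x ++ repr y).
Definition hnn_inv_elt (x : hnn_extension) : hnn_extension :=
  \pi_hnn_extension (hnn_word_inv (repr x)).

Lemma hnn_repr (u : hnn_word G) : hnn_cong (repr (\pi_hnn_extension u)) u.
Proof. by apply/hnn_piP; rewrite reprK. Qed.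

Lemma hnn_mul_pi (u v : hnn_word G) :
  hnn_mul_elt (\pi_hnn_extension u) (\pi_hnn_extension v) =
  \pi_hnn_extension (u ++ v).
Proof. by apply/hnn_piP; apply: hnn_cat; exact: hnn_repr. Qed.

Lemma hnn_mulA : associative hnn_mul_elt.
Proof.
move=> x y z; rewrite -(reprK x) -(reprK y) -(reprK z).
move: (repr x) (repr y) (repr z) => u v w.
by rewrite (hnn_mul_pi v w) (hnn_mul_pi u v) !hnn_mul_pi catA.
Qed.

Lemma hnn_mul1 : left_id hnn_one_elt hnn_mul_elt.
Proof. by move=> x; rewrite -(reprK x) hnn_mul_pi. Qed.

Lemma hnn_mulr1 : right_id hnn_one_elt hnn_mul_elt.
Proof. by move=> x; rewrite -(reprK x) hnn_mul_pi cats0. Qed.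

Lemma hnn_mulV : left_inverse hnn_one_elt hnn_inv_elt hnn_mul_elt.
Proof.
move=> x; rewrite -[X in hnn_mul_elt _ X](reprK x) hnn_mul_pi.
by apply/hnn_piP; exact: hnn_word_Vmul.
Qed.

Lemma hnn_mulrV : right_inverse hnn_one_elt hnn_inv_elt hnn_mul_elt.
Proof.
move=> x; rewrite -[X in hnn_mul_elt X _](reprK x) hnn_mul_pi.
by apply/hnn_piP; exact: hnn_word_mulV.
Qed.

HB.instance Definition _ := isGroup.Build hnn_extension
  hnn_mulA hnn_mul1 hnn_mulr1 hnn_mulV hnn_mulrV.

Definition hnn_base (g : G) : hnn_extension := \pi_hnn_extension [:: inl g].
Definition hnn_t : hnn_extension := \pi_hnn_extension [:: inr true].

Lemma hnn_baseM : {morph hnn_base : g g' / (g * g')%g}.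
Proof.
move=> g g'; rewrite [RHS]hnn_mul_pi.
by apply/hnn_piP; apply: hnn_sym; exact: hnn_mul.
Qed.

Lemma hnn_tVE : (hnn_t^-1)%g = \pi_hnn_extension [:: inr false].
Proof.
apply: (mulgI hnn_t); rewrite mulgV [RHS]hnn_mul_pi.
by apply/hnn_piP; apply: hnn_sym; exact: hnn_tV.
Qed.

Lemma hnn_conjE : {in H, forall h,
  (hnn_t * hnn_base h * hnn_t^-1)%g = hnn_base (alpha h)}.
Proof.
move=> h hH; rewrite hnn_tVE.
rewrite [X in (X * _)%g]hnn_mul_pi [LHS]hnn_mul_pi /=.
by apply/hnn_piP; exact: hnn_conj.
Qed.

Lemma hnn_universal (E : groupType) (f : G -> E) (s : E) :
  {morph f : x y / (x * y)%g} ->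
  {in H, forall h, (s * f h * s^-1)%g = f (alpha h)} ->
  exists! F : hnn_extension -> E,
    [/\ {morph F : x y / (x * y)%g}, forall g, F (hnn_base g) = f g
      & F hnn_t = s].
Proof.
move=> fM fc.
have f1 : f 1%g = 1%g by apply: (mulgI (f 1%g)); rewrite -fM !mulg1.
pose l (a : G + bool) : E :=
  match a with inl g => f g | inr b => if b then s else (s^-1)%g end.
pose W (u : hnn_word G) : E := foldr (fun a x => (l a * x)%g) 1%g u.
have WM u v : W (u ++ v) = (W u * W v)%g.
  by elim: u => [|a u IH] /=; rewrite ?mul1g// IH mulgA.
have WE u v : hnn_cong u v -> W u = W v.
  elim=> {u v} [//|//|v u w _ -> _ ->//||||||] /=.
  - by move=> u u' v v' _ uu _ vv; rewrite !WM uu vv.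
  - by rewrite f1 mulg1.
  - by move=> g g'; rewrite !mulg1 fM.
  - by rewrite mulg1 mulgV.
  - by rewrite mulg1 mulVg.
  - by move=> h hH; rewrite !mulg1 mulgA fc.
have Wr u : W (repr (\pi_hnn_extension u)) = W u by apply/WE/hnn_repr.
exists (W \o repr); split.
  split=> [x y|g|] /=.
  - rewrite -(reprK x) -(reprK y); move: (repr x) (repr y) => u v.
    by rewrite [X in repr X]hnn_mul_pi !Wr WM.
  - by rewrite Wr /= mulg1.
  - by rewrite Wr /= mulg1.
move=> F [FM Fb Ft]; apply/funext => x /=; rewrite -{2}(reprK x).
have F1 : F 1%g = 1%g by apply: (mulgI (F 1%g)); rewrite -FM !mulg1.
elim: (repr x) => [|a u IH] /=; first exact: (esym F1).
rewrite -cat1s -hnn_mul_pi [RHS]FM -IH; congr (_ * _)%g.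
case: a => [g|[]] /=; [by rewrite Fb|by rewrite Ft|].
by rewrite -hnn_tVE; apply: (mulgI s); rewrite mulgV -Ft -FM mulgV F1.
Qed.

End HNNExtension.

(* Main.v *)
(* Gamma = G*_alpha acts on its Bass-Serre tree, whose vertices are the cosets
   of G. For x in Gamma the vertex xG is recorded by the stack of the normal form
   of x, right multiplication by a letter keeps, pops or pushes the stack, and
   popping is moving towards the base vertex. The set W_n of the elements at depth
   at most n has property A by induction on n: W_(n+1) consists of W_n and of
   translates of G which are far apart away from W_n. Averaging over the first n
   ancestors v of xG the means given by the translate of W_n based at v then gives
   property A of Gamma, since ancestors of adjacent vertices agree up to a shift.
   Finite subsets of X * nat are replaced by finitely supported probability
   measures, seen as linear functionals; the l^1 distance is tested on functions
   bounded by 1. *)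
Require Import Defs.
From HB Require Import structures.
From mathcomp Require Import all_boot all_order all_algebra finmap.
From mathcomp Require Import all_classical all_reals all_analysis.
From mathcomp Require Import ring lra zify.

Set Implicit Arguments.
Unset Strict Implicit.
Unset Printing Implicit Defensive.

Import Order.TTheory GRing.Theory Num.Theory.

Local Open Scope classical_set_scope.
Local Open Scope ring_scope.

(** * Means *)

Section Mean.
Variable R : realType.

(** Positivity is tested on [B] alone, so [m f] depends only on the values of [f] on [B]
    ([mean_on_eq]). For finite [B] this is a probability measure on [B]. *)
Definition mean_on (T : Type) (B : set T) (m : (T -> R) -> R) : Prop :=
  [/\ forall a f g, m (fun z => a * f z + g z) = a * m f + m g,
      forall f, (forall z, B z -> 0 <= f z) -> 0 <= m f
    & m (fun=> 1) = 1].

Section Theory.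
Context {T : Type}.
Implicit Types (B : set T) (m : (T -> R) -> R) (f g : T -> R).

Lemma mean_onD B m f g : mean_on B m ->
  m (fun z => f z + g z) = m f + m g.
Proof.
move=> [lin _ _]; have := lin 1 f g; rewrite mul1r => <-; congr m.
by apply/funext => z; rewrite mul1r.
Qed.

Lemma mean_on0 B m : mean_on B m -> m (fun=> 0) = 0.
Proof.
move=> mB; have := mean_onD (fun=> 0) (fun=> 0) mB.
have -> : (fun _ : T => 0 + 0 : R) = fun=> 0 by apply/funext => z; rewrite addr0.
lra.
Qed.

Lemma mean_onZ B m a f : mean_on B m -> m (fun z => a * f z) = a * m f.
Proof.
move=> mB; have [lin _ _] := mB; have := lin a f (fun=> 0).
rewrite (mean_on0 mB) addr0 => <-; congr m.
by apply/funext => z; rewrite addr0.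
Qed.

Lemma mean_onN B m f : mean_on B m -> m (fun z => - f z) = - m f.
Proof.
move=> mB; rewrite -mulN1r -(mean_onZ _ _ mB); congr m.
by apply/funext => z; rewrite mulN1r.
Qed.

Lemma mean_on_sum B m (I : Type) (s : seq I) (F : I -> T -> R) :
  mean_on B m -> m (fun z => \sum_(i <- s) F i z) = \sum_(i <- s) m (F i).
Proof.
move=> mB; elim: s => [|i s IH].
  rewrite big_nil -[RHS](mean_on0 mB); congr m.
  by apply/funext => z; rewrite big_nil.
rewrite big_cons -IH -(mean_onD _ _ mB); congr m.
by apply/funext => z; rewrite big_cons.
Qed.

Lemma mean_on_le B m f g : mean_on B m ->
  (forall z, B z -> f z <= g z) -> m f <= m g.
Proof.
move=> mB fg; have [_ pos _] := mB.
rewrite -subr_ge0 -(mean_onN _ mB) -(mean_onD _ _ mB).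
by apply: pos => z /fg; rewrite subr_ge0.
Qed.

Lemma mean_on_eq B m f g : mean_on B m ->
  (forall z, B z -> f z = g z) -> m f = m g.
Proof.
by move=> mB fg; apply/eqP; rewrite eq_le !(mean_on_le mB)// => z /fg ->.
Qed.

Lemma mean_on_ler1 B m f : mean_on B m -> (forall z, `|f z| <= 1) -> `|m f| <= 1.
Proof.
move=> mB f1; have [_ _ m1] := mB.
have m_le g : (forall z, g z <= 1) -> m g <= 1.
  by move=> g1; rewrite -[leRHS]m1 (mean_on_le mB).
by rewrite ler_norml lerNl -(mean_onN _ mB) !m_le// => z;
  have := f1 z; rewrite ler_norml lerNl => /andP[].
Qed.

Lemma sub_mean_on B B' m : B `<=` B' -> mean_on B m -> mean_on B' m.
Proof. by move=> BB' [lin pos m1]; split=> // f f0; apply: pos => z /BB'/f0. Qed.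

Lemma mean_on_dirac B x : B x -> mean_on B (fun f => f x).
Proof. by move=> Bx; split=> // f; apply. Qed.

Lemma mean_on_convex B m m' (a : R) : 0 <= a <= 1 ->
  mean_on B m -> mean_on B m' -> mean_on B (fun f => (1 - a) * m f + a * m' f).
Proof.
move=> /andP[a0 a1] [lin pos m1] [lin' pos' m1']; split.
- by move=> b f g; rewrite lin lin'; ring.
- by move=> f f0; rewrite addr_ge0// mulr_ge0 ?subr_ge0// (pos, pos').
- by rewrite m1 m1'; ring.
Qed.

Lemma mean_on_average B (n : nat) (m : nat -> (T -> R) -> R) :
  (forall k, (k < n.+1)%N -> mean_on B (m k)) ->
  mean_on B (fun f => (\sum_(0 <= k < n.+1) m k f) / n.+1%:R).
Proof.
move=> mB; split.
- move=> a f g; rewrite mulrA -mulrDl mulr_sumr -big_split/=; congr (_ / _).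
  apply: eq_big_nat => k /andP[_ kn].
  by have [-> _ _] := mB _ kn.
- move=> f f0; rewrite divr_ge0// big_nat sumr_ge0// => k kn.
  by have [_ + _] := mB _ kn; apply.
- rewrite (eq_big_nat _ _ (F2 := fun=> 1)); last first.
    by move=> k kn; have [_ _ ->] := mB _ kn.
  by rewrite sumr_const_nat subn0 divff// pnatr_eq0.
Qed.

End Theory.

Lemma mean_on_image (T T' : Type) (B : set T) (B' : set T') (h : T -> T') m :
  (forall z, B z -> B' (h z)) -> mean_on B m -> mean_on B' (fun f => m (f \o h)).
Proof.
move=> BB' [lin pos m1]; split=> //.
- by move=> a f g; rewrite -lin.
- by move=> f f0; apply: pos => z /BB'/f0.
Qed.

Definition point_mass (T : choiceType) (m : (T -> R) -> R) (z : T) : R :=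
  m (fun y => (y == z)%:R).

(** On [C] the function [f] agrees with a finite combination of indicators of points. *)
Lemma mean_on_point_mass (T : choiceType) (C : {fset T}) m f :
  mean_on [set` C] m -> m f = \sum_(z <- C) f z * point_mass m z.
Proof.
move=> mC; under eq_bigr do rewrite /point_mass -(mean_onZ _ _ mC).
rewrite -(mean_on_sum _ _ mC); apply: (mean_on_eq mC) => y /= yC.
rewrite (big_fsetD1 y)//= eqxx mulr1 big_seq big1 ?addr0//.
by move=> z; rewrite !inE eq_sym => /andP[/negPf-> _]; rewrite mulr0.
Qed.

Lemma point_mass_ge0 (T : choiceType) B (m : (T -> R) -> R) z :
  mean_on B m -> 0 <= point_mass m z.
Proof. by move=> [_ pos _]; apply: pos => y _; rewrite ler0n. Qed.

End Mean.

(** * Normal forms in the HNN extension *)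

Section NormalForm.
Local Open Scope group_scope.
Context {G : groupType} (H K : groupClosed G) (alpha beta : G -> G).

Record associated : Prop := Associated {
  alphaM : {in H &, {morph alpha : x y / x * y}};
  alpha_in : forall x, x \in H -> alpha x \in K;
  beta_in : forall x, x \in K -> beta x \in H;
  alphaK : {in H, cancel alpha beta};
  betaK : {in K, cancel beta alpha} }.

(** For k in [side e] the relations give k t^e = t^e [transfer e k] ([letter_transfer]). *)
Definition side (e : bool) : groupClosed G := if e then K else H.
Definition transfer (e : bool) : G -> G := if e then beta else alpha.

(** [choose] depends on the predicate only, so all elements of a left coset of [side e] get the same
    representative. That of [side e] itself need not be 1. *)
Definition coset_rep (e : bool) (g : G) : G :=
  choose (fun z => g^-1 * z \in side e) g.

Lemma coset_repP e g : g^-1 * coset_rep e g \in side e.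
Proof.
by apply: (@chooseP _ (fun z => g^-1 * z \in side e) g); rewrite mulVg gpred1.
Qed.

Lemma coset_repM e g k : k \in side e -> coset_rep e (g * k) = coset_rep e g.
Proof.
move=> ke; have E : (fun z => (g * k)^-1 * z \in side e) =1
                    (fun z => g^-1 * z \in side e).
  by move=> z; rewrite invgM -mulgA gpredMl// gpredV.
rewrite /coset_rep (eq_choose E); apply: choose_id.
  by rewrite mulKg.
by rewrite mulVg gpred1.
Qed.

Lemma coset_rep_id e g : coset_rep e (coset_rep e g) = coset_rep e g.
Proof. by rewrite -[in LHS](mulVKg g (coset_rep e g)) coset_repM// coset_repP. Qed.

Lemma coset_rep_in e g : (coset_rep e g \in side e) = (g \in side e).
Proof. by rewrite -[X in X \in _](mulVKg g) gpredMr// coset_repP. Qed.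

Lemma coset_repV e g : (coset_rep e g)^-1 * g \in side e.
Proof. by rewrite -gpredV invgM invgK coset_repP. Qed.

(* [(s, g)] with [s = (r_n, e_n) :: .. :: (r_1, e_1) :: [::]] stands for
   [r_1 t^e_1 .. r_n t^e_n g]; the exponent [true] is [1], [false] is [-1]. *)
Definition nform : Type := (seq (G * bool) * G)%type.

(** With r the representative of g, g t^e = r (r^-1 g) t^e = r t^e [transfer e (r^-1 g)]. *)
Definition push (e : bool) (x : nform) : nform :=
  ((coset_rep e x.2, e) :: x.1, transfer e ((coset_rep e x.2)^-1 * x.2)).

(** Popping is the cancellation t^-e g t^e = [transfer e g] for g in [side e]. *)
Definition act (x : nform) (a : G + bool) : nform :=
  match a, x.1 with
  | inl g, s => (s, x.2 * g)
  | inr e, (r, e') :: s =>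
    if (e' != e) && (x.2 \in side e) then (s, r * transfer e x.2) else push e x
  | inr e, [::] => push e x
  end.

Definition acts (x : nform) (u : hnn_word G) : nform := foldl act x u.

Lemma acts_cat x u v : acts x (u ++ v) = acts (acts x u) v.
Proof. exact: foldl_cat. Qed.

(** In the sorted condition q lies just below p in the stack: there is no pinch t^-e r t^e with r in
    [side e]. *)
Definition reduced (s : seq (G * bool)) : bool :=
  all (fun p => coset_rep p.2 p.1 == p.1) s &&
  sorted (fun p q => (q.2 == p.2) || (p.1 \notin side p.2)) s.

Lemma act_reduced x a : reduced x.1 -> reduced (act x a).1.
Proof.
case: a => [//|e]; case: x => -[|[r e'] s] g; rewrite /reduced /=.
  by rewrite coset_rep_id eqxx.
move=> /andP[/andP[rr ss] ps].
case: ifP => /= [_|C].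
  by rewrite ss (path_sorted ps).
rewrite coset_rep_id eqxx rr ss ps /= andbT coset_rep_in.
by case: eqP C => //= _ ->.
Qed.

Lemma acts_reduced x u : reduced x.1 -> reduced (acts x u).1.
Proof. by elim: u x => //= a u IH x /(act_reduced a)/IH. Qed.

Hypothesis assoc : associated.

Lemma transfer_in e x : x \in side e -> transfer e x \in side (~~ e).
Proof. by case: e; [exact: beta_in|exact: alpha_in]. Qed.

Lemma transferK e x : x \in side e -> transfer (~~ e) (transfer e x) = x.
Proof. by case: e; [exact: betaK|exact: alphaK]. Qed.

Lemma transferM e : {in side e &, {morph transfer e : x y / x * y}}.
Proof.
case: e => /= x y xe ye; last exact: alphaM.
rewrite -{1}(betaK assoc xe) -{1}(betaK assoc ye) -(alphaM assoc) ?beta_in//.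
by rewrite (alphaK assoc)// gpredM ?beta_in.
Qed.

(** After a pop, reducedness keeps the opposite letter from popping once more, and the entry pushed
    back is the canonical representative that was removed. *)
Lemma actK e x : reduced x.1 -> act (act x (inr e)) (inr (~~ e)) = x.
Proof.
have pushK y : act (push e y) (inr (~~ e)) = y.
  case: y => s g; rewrite /= transfer_in ?coset_repV// andbT.
  have -> : (e != ~~ e) by case: (e).
  by rewrite transferK ?coset_repV// mulVKg.
case: x => -[|[r e'] s] g; first by move=> _; rewrite [act _ (inr e)]/= pushK.
move=> red; rewrite [act _ (inr e)]/=; case: ifP => [/andP[nee ge]|_]; last first.
  exact: pushK.
have {nee} e'E : e' = ~~ e by case: (e) (e') nee => [] [].
move: red; rewrite e'E /reduced /= => /andP[/andP[/eqP rr ss] ps].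
have te := transfer_in ge.
have pushE : push (~~ e) (s, r * transfer e g) = ((r, ~~ e) :: s, g).
  by rewrite /push /= coset_repM//= rr mulKg transferK.
case: s ps {ss} pushE => [//|[r' e''] s] /= /andP[+ _].
by rewrite gpredMr//; case: (e'' =P ~~ e) => [->|_]/=; rewrite ?eqxx// => /negPf->.
Qed.

Lemma act_conj x h : h \in H ->
  act (act x (inr true)) (inl h) = act (act x (inl (alpha h))) (inr true).
Proof.
move=> hH; have aK := alpha_in assoc hH.
have bE k : k \in K -> beta k * h = beta (k * alpha h).
  by move=> kK; have /= -> := transferM (e := true) kK aK; rewrite (alphaK assoc).
have pushE s g : act (push true (s, g)) (inl h) = push true (s, g * alpha h).
  rewrite /push /= coset_repM//; congr pair.
  by rewrite /= bE -?mulgA//; exact: (coset_repV true).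
case: x => -[|[r e'] s] g; first exact: (pushE [::]).
rewrite /= gpredMr//; case: ifP => [/andP[_ gK]|_]; last exact: (pushE ((r, e') :: s)).
by rewrite /= -mulgA bE.
Qed.

(** Van der Waerden's trick: the action of words on reduced forms respects each defining relation,
    so it descends to the extension. *)
Lemma acts_cong u v : hnn_cong H alpha u v ->
  forall x, reduced x.1 -> acts x u = acts x v.
Proof.
elim=> {u v} [//|u v _ IH x xr|v u w _ IH _ IH' x xr|u u' v v' _ IH _ IH' x xr||||| h hH].
- by rewrite IH.
- by rewrite IH// IH'.
- by rewrite !acts_cat IH// IH' ?acts_reduced.
- by move=> [s g] _ /=; rewrite mulg1.
- by move=> g g' [s g0] _ /=; rewrite mulgA.
- by move=> x xr /=; exact: (actK true).
- by move=> x xr /=; exact: (actK false).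
- move=> x xr; rewrite -[LHS]/(act (act (act x (inr true)) (inl h)) (inr false)).
  by rewrite act_conj//; apply: (actK true); exact: (act_reduced (inl _)).
Qed.

Notation Gamma := (hnn_extension H alpha).
Notation pi := (\pi_Gamma)%qT.

Lemma pi_cat (u v : hnn_word G) : pi (u ++ v) = pi u * pi v.
Proof. by rewrite [RHS]hnn_mul_pi. Qed.

Definition normal_form (x : Gamma) : nform := acts ([::], 1) (repr x).

Lemma normal_form_mul x u : normal_form (x * pi u) = acts (normal_form x) u.
Proof.
rewrite -acts_cat -{1}(reprK x) -pi_cat.
by apply: acts_cong => //; exact: hnn_repr.
Qed.

Definition branch (s : seq (G * bool)) : Gamma :=
  foldr (fun p y => y * hnn_base H alpha p.1 * pi [:: inr p.2]) 1 s.

Definition nf_val (x : nform) : Gamma := branch x.1 * hnn_base H alpha x.2.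

Lemma letter_transfer e k : k \in side e ->
  hnn_base H alpha k * pi [:: inr e] = pi [:: inr e] * hnn_base H alpha (transfer e k).
Proof.
have tV : pi [:: inr false] = (hnn_t H alpha)^-1 by rewrite hnn_tVE.
case: e => /= ke.
  rewrite -{1}(betaK assoc ke) -hnn_conjE ?beta_in//.
  by rewrite mulgVK.
by rewrite tV -hnn_conjE// !mulgA mulVg mul1g.
Qed.

Lemma nf_val_act x a : nf_val (act x a) = nf_val x * pi [:: a].
Proof.
case: x => s g; rewrite /nf_val; case: a => [g'|e] /=.
  by rewrite hnn_baseM mulgA.
have pushE : branch (push e (s, g)).1 * hnn_base H alpha (push e (s, g)).2 =
             branch s * hnn_base H alpha g * pi [:: inr e].
  rewrite /push /= -[_ * hnn_base _ _ (transfer _ _)]mulgA.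
  by rewrite -letter_transfer ?coset_repV// -mulgA !mulgA -[X in X * _]mulgA -hnn_baseM mulVKg.
case: s pushE => [//|[r e'] s] pushE; case: ifP => // /andP[nee ge] /=.
rewrite hnn_baseM -[RHS]mulgA (letter_transfer ge) !mulgA; congr (_ * _).
rewrite -[RHS]mulgA -(pi_cat [:: inr e'] [:: inr e]).
rewrite [pi _](_ : _ = 1) ?mulg1//.
by apply/hnn_piP; case: (e) (e') nee => [] [] // _; [exact: hnn_Vt|exact: hnn_tV].
Qed.

Lemma nf_val_acts x u : nf_val (acts x u) = nf_val x * pi u.
Proof.
elim: u x => [|a u IH] x /=; first by rewrite [pi [::]](_ : _ = 1) ?mulg1.
by rewrite IH nf_val_act -mulgA -(pi_cat [:: a]).
Qed.

Lemma normal_formK : cancel normal_form nf_val.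
Proof.
move=> x; rewrite nf_val_acts reprK /nf_val /=.
rewrite [hnn_base _ _ _](_ : _ = 1) ?mul1g//.
by apply/hnn_piP; exact: hnn_one.
Qed.

Definition stack x := (normal_form x).1.

Lemma normal_form1 : normal_form 1 = ([::], 1).
Proof. by rewrite /normal_form (acts_cong (hnn_repr _ _ _)). Qed.

Lemma normal_form_base g : normal_form (hnn_base H alpha g) = ([::], g).
Proof. by rewrite -[hnn_base _ _ g]mul1g normal_form_mul normal_form1 /= mul1g. Qed.

(** The normal form of [hnn_base H alpha g] still shows [g]. *)
Lemma hnn_base_inj : injective (hnn_base H alpha).
Proof. by move=> g g' /(congr1 normal_form); rewrite !normal_form_base => -[]. Qed.

(** A letter moves the vertex xG of the Bass-Serre tree along at most one edge. *)
Lemma stack_letter x a :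
  [\/ stack (x * pi [:: a]) = stack x,
      stack (x * pi [:: a]) = behead (stack x) |
      exists p, stack (x * pi [:: a]) = p :: stack x].
Proof.
rewrite /stack normal_form_mul /=; case: (normal_form x) => s g.
case: a => [g'|e]; first by constructor 1.
case: s => [|[r e'] s] /=; first by constructor 3; eexists.
by case: ifP => _; [constructor 2|constructor 3; eexists].
Qed.

Lemma stack_base x g : stack (x * hnn_base H alpha g) = stack x.
Proof. by rewrite /stack normal_form_mul. Qed.

Lemma branch_cat s s' : branch (s ++ s') = branch s' * branch s.
Proof. by elim: s => [|p s IH] /=; rewrite ?mulg1// IH !mulgA. Qed.

Lemma size_stack_branch s g : (size (stack (branch s * hnn_base H alpha g)%g) <= size s)%N.
Proof.
rewrite stack_base; elim: s => [|p s IH] /=.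
  by rewrite /stack normal_form1.
have := stack_letter (branch s * hnn_base H alpha p.1) (inr p.2); rewrite stack_base.
by case=> [->|->|[q ->]]; rewrite ?size_behead/=; lia.
Qed.

(** Here [drop k (stack x)] is the k-th ancestor of xG. Translating it to the base vertex brings x
    to depth at most k. *)
Lemma stack_split x k :
  exists y, x = branch (drop k (stack x)) * y /\ (size (stack y) <= k)%N.
Proof.
exists (branch (take k (stack x)) * hnn_base H alpha (normal_form x).2); split.
  by rewrite mulgA -branch_cat cat_take_drop -[LHS]normal_formK.
by rewrite (leq_trans (size_stack_branch _ _))// size_take_min geq_minl.
Qed.

(* A path in the Bass-Serre tree leaves the subtree above a vertex only
   through the edge leading from that vertex to its parent. *)
Lemma stack_subtree x u w s : stack x = w ++ s ->
  (exists w', stack (x * pi u) = w' ++ s) \/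
  exists v v', u = v ++ v' /\ (size (stack (x * pi v)%g) < size s)%N.
Proof.
have pi_nil : pi [::] = 1 by [].
elim: u x w => [|a u IH] x w xs.
  by left; exists w; rewrite pi_nil mulg1.
have [[w' xas]|xas] : (exists w', stack (x * pi [:: a]) = w' ++ s) \/
    (size (stack (x * pi [:: a])%g) < size s)%N.
  case: (stack_letter x a) => [|->|[p ->]]; rewrite ?xs; last 1 first.
  - by left; exists (p :: w).
  - by move=> ->; left; exists w.
  case: w {xs} => [|p w]; last by left; exists w.
  by case: s {IH} => [|p s]; [left; exists [::]|right].
- have -> : x * pi (a :: u) = x * pi [:: a] * pi u by rewrite -mulgA -(pi_cat [:: a]).
  case: (IH _ _ xas) => [|[v [v' [-> vs]]]]; first by left.
  right; exists (a :: v), v'; split=> //.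
  by move: vs; rewrite -mulgA -(pi_cat [:: a]).
- by right; exists [:: a], u.
Qed.

(** If x has depth n + 1, the subtree above xG contains no other vertex of depth at most n + 1, so a
    path to another such vertex leaves this subtree and passes through depth n. *)
Lemma stack_separation n x u : (size (stack x) <= n.+1)%N ->
  (size (stack (x * pi u)%g) <= n.+1)%N -> stack (x * pi u) <> stack x ->
  exists v v', u = v ++ v' /\ (size (stack (x * pi v)%g) <= n)%N.
Proof.
move=> xn yn yx; case: (leqP (size (stack x)) n) => xn'.
  by exists [::], u; rewrite [pi [::]](_ : _ = 1) ?mulg1.
have {xn xn'} xn : size (stack x) = n.+1 by apply/eqP; rewrite eqn_leq xn.
have [[[|p w] ys]|] := @stack_subtree x u [::] (stack x) erefl.
- by rewrite ys in yx.
- by move: yn; rewrite ys size_cat xn /=; lia.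
- by rewrite xn.
Qed.

End NormalForm.

(** * Weighted word length on the extension *)

Section Length.
Local Open Scope group_scope.
Context {G : groupType} (H : {pred G}) (alpha : G -> G) (w : G -> nat).
Hypothesis wV : forall g, w g^-1 = w g.
Hypothesis w_fin : forall n, finite_set [set g | w g <= n]%N.

Notation Gamma := (hnn_extension H alpha).
Notation pi := (\pi_Gamma)%qT.

(** The successor gives every letter weight at least 1, even where [w] vanishes, so bounded weight
    bounds the number of letters. *)
Definition letter_weight (a : G + bool) : nat := if a is inl g then (w g).+1 else 1.

Definition word_weight (u : hnn_word G) : nat := sumn (map letter_weight u).

Lemma word_weight_cat (u v : hnn_word G) :
  word_weight (u ++ v) = (word_weight u + word_weight v)%N.
Proof. by rewrite /word_weight map_cat sumn_cat. Qed.

Lemma word_weight_inv u : word_weight (hnn_word_inv u) = word_weight u.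
Proof.
rewrite /word_weight /hnn_word_inv map_rev sumn_rev -map_comp; congr sumn.
by apply: eq_map => -[g|b] //=; rewrite wV.
Qed.

Lemma size_word_weight u : (size u <= word_weight u)%N.
Proof. by elim: u => //= -[g|b] u IH; rewrite /word_weight /= -/(word_weight u); lia. Qed.

Lemma finite_words n : finite_set [set u | word_weight u <= n]%N.
Proof.
have letters k : finite_set [set a | letter_weight a <= k]%N.
  apply: (@sub_finite_set _ _ (inl @` [set g | w g <= k]%N `|` inr @` setT)).
    by move=> [g|b] /= ab; [left; exists g => //; apply: ltnW|right; exists b].
  by rewrite finite_setU; split; apply: finite_image.
elim: n => [|n IH].
  apply: (@sub_finite_set _ _ [set [::]]) => // -[//|a u].
  by have := size_word_weight (a :: u); rewrite /=; lia.
apply: (@sub_finite_set _ _ ([set [::]] `|`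
    [set (a :: u) | a in [set a | letter_weight a <= n.+1]%N
                  & u in [set u | word_weight u <= n]%N])).
  move=> [|a u] /= au; first by left.
  right; exists a => /=; last exists u => //=; move: au; rewrite /word_weight/=.
    by lia.
  by case: a => [g|b] /=; lia.
by rewrite finite_setU; split=> //; exact: finite_image2.
Qed.

Lemma ex_word_weight (x : Gamma) :
  exists n, `[< exists2 u, pi u = x & word_weight u = n >].
Proof.
by exists (word_weight (repr x)); apply/asboolP; exists (repr x); rewrite ?reprK.
Qed.

Definition hnn_length (x : Gamma) : nat := ex_minn (ex_word_weight x).

Lemma hnn_lengthP x : exists2 u, pi u = x & word_weight u = hnn_length x.
Proof. by rewrite /hnn_length; case: ex_minnP => n /asboolP. Qed.

Lemma hnn_length_le u : (hnn_length (pi u) <= word_weight u)%N.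
Proof.
by rewrite /hnn_length; case: ex_minnP => n _; apply; apply/asboolP; exists u.
Qed.

Lemma hnn_length_base g : (hnn_length (hnn_base H alpha g) <= (w g).+1)%N.
Proof. by rewrite (leq_trans (hnn_length_le _))// /word_weight /= addn0. Qed.

End Length.

(** * Property A of subsets of a group with a length *)

Record proper_length (Gamma : groupType) (len : Gamma -> nat) : Prop := ProperLength {
  len_eq0 : forall x, len x = 0%N <-> x = 1%g;
  lenV : forall x, len x^-1%g = len x;
  lenM : forall x y, (len (x * y)%g <= len x + len y)%N;
  len_finite : forall n, finite_set [set x | len x <= n]%N }.

Section UniformA.
Variables (R : realType) (Gamma : groupType) (len : Gamma -> nat).
Hypothesis len_proper : proper_length len.

(** The bound over all such f is a bound on the l^1 distance of the means; replacing f by -f makes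
    it two-sided. *)
Definition close_on (s r : nat) (eps : R) (D : set Gamma)
    (m : Gamma -> (Gamma -> R) -> R) : Prop :=
  (forall x, D x -> mean_on [set z | len (x^-1 * z)%g <= s]%N (m x)) /\
  (forall x y, D x -> D y -> (len (x^-1 * y)%g <= r)%N ->
    forall f, (forall z, `|f z| <= 1) -> m x f - m y f <= eps).

Definition uniform_A (I : Type) (D : I -> set Gamma) : Prop :=
  forall r eps, 0 < eps -> exists s m, forall i, close_on s r eps (D i) (m i).

Definition set_A (D : set Gamma) : Prop :=
  forall r eps, 0 < eps -> exists s m, close_on s r eps D m.

(** [len (x^-1 * y)] is invariant under left translation, so the means on [W] are carried to all
    translates with one common radius. *)
Lemma uniform_A_translate (I : Type) (D : I -> set Gamma) (W : set Gamma)
    (g : I -> Gamma) :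
  set_A W -> (forall i x, D i x -> W ((g i)^-1 * x)%g) -> uniform_A D.
Proof.
move=> WA DW r eps eps0; have [s [m [mean close]]] := WA r eps eps0.
exists s, (fun i x f => m ((g i)^-1 * x)%g (f \o *%g (g i))) => i; split.
- move=> x /DW /mean; apply: mean_on_image => z /=.
  by rewrite invgM invgK mulgA.
- move=> x y /DW Wx /DW Wy xy f f1; apply: close => // [|z]; last exact: f1.
  by rewrite invgM invgK -mulgA mulVKg.
Qed.

(* The mean at [x] interpolates between the given means on [W] and on the class
   of [x]; distinct classes interact only near [W], where the latter have small
   weight. *)
Lemma set_A_union (I : Type) (c : Gamma -> I) (W W' : set Gamma) :
  set_A W -> uniform_A (fun i => [set x | c x = i]) ->
  (forall r x y, W' x -> W' y -> (len (x^-1 * y)%g <= r)%N -> c x <> c y ->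
    exists2 z, W z & (len (z^-1 * x)%g <= r)%N) ->
  set_A W'.
Proof.
move=> WA cA sep r eps eps0.
(* Weights will be distances to [W] divided by [L]: a change of the distance by [r] changes a weight
   by at most eps / 8. *)
pose L := (Num.truncn (r%:R * 8 / eps)).+1.
have L0 : 0 < L%:R :> R by rewrite ltr0n.
have rL : r%:R / L%:R <= eps / 8.
  have : r%:R * 8 / eps < L%:R by apply: truncnS_gt.
  by rewrite !ltr_pdivrMr// ler_pdivrMr//; lra.
have e4 : 0 < eps / 4 by lra.
(* If x and y are [r]-close, points of [W] within [L] of x and of y are within L + r + L of each
   other. *)
have [sW [mW [meanW closeW]]] := WA (L + r + L)%N _ e4.
have [sC [mC mCP]] := cA r _ e4.
(* The distance to [W] is truncated at [L], which also covers an empty [W]. *)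
have near_ex x : exists k, `[< k = L \/ exists2 z, W z & (len (z^-1 * x)%g <= k)%N >].
  by exists L; apply/asboolP; left.
pose dist x := ex_minn (near_ex x).
have dist_le x : (dist x <= L)%N.
  by rewrite /dist; case: ex_minnP => k _; apply; apply/asboolP; left.
have distP x : (dist x < L)%N -> exists2 z, W z & (len (z^-1 * x)%g <= dist x)%N.
  by rewrite /dist; case: ex_minnP => k /asboolP[->|//]; rewrite ltnn.
have dist_min x z k : W z -> (len (z^-1 * x)%g <= k)%N -> (dist x <= k)%N.
  move=> Wz zx; rewrite /dist; case: ex_minnP => j _; apply; apply/asboolP.
  by right; exists z.
have len_sym x y : len (x^-1 * y)%g = len (y^-1 * x)%g.
  by rewrite -(lenV len_proper) invgM invgK.
have len_tri x y z : (len (x^-1 * z)%g <= len (x^-1 * y)%g + len (y^-1 * z)%g)%N.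
  by apply: leq_trans (lenM len_proper _ _); rewrite mulgA mulgK.
have dist_lip x y : (len (x^-1 * y)%g <= r)%N -> (dist y <= dist x + r)%N.
  move=> xy; case: (ltnP (dist x) L) => [/distP[z Wz zx]|Lx]; last first.
    by rewrite (leq_trans (dist_le y))// (leq_trans Lx)// leq_addr.
  by apply: (dist_min _ _ _ Wz); have := len_tri z x y; lia.
have /choice[p pP] : forall x, exists z, (dist x < L)%N ->
    W z /\ (len (z^-1 * x)%g <= L)%N.
  move=> x; case: (ltnP (dist x) L) => [xL|_]; last by exists 1%g.
  have [z Wz zx] := distP x xL; exists z => _; split=> //.
  by rewrite (leq_trans zx)// ltnW.
(* From distance [L] on, the weight 1 - a x vanishes; the Dirac mass only keeps [mP x] a mean. *)
pose mP x := if (dist x < L)%N then mW (p x) else fun f => f x.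
pose a x : R := (dist x)%:R / L%:R.
pose s := (L + sW + sC)%N.
pose B x : set Gamma := [set z | len (x^-1 * z)%g <= s]%N.
have meanP x : mean_on (B x) (mP x).
  rewrite /mP; case: ifP => xL; last first.
    by apply: mean_on_dirac; rewrite /B /= mulVg (proj2 (len_eq0 len_proper _)).
  have [Wp px] := pP x xL; apply: sub_mean_on (meanW _ Wp) => z /= pz.
  by rewrite /B /=; have := len_tri x (p x) z; rewrite (len_sym x (p x)) /s; lia.
have meanC x : mean_on (B x) (mC (c x) x).
  have [+ _] := mCP (c x); move=> /(_ x erefl); apply: sub_mean_on => z /=.
  by rewrite /B /= /s; lia.
have a01 x : 0 <= a x <= 1.
  by rewrite divr_ge0//= ler_pdivrMr// mul1r ler_nat.
have a_lip x y : (len (x^-1 * y)%g <= r)%N -> a y - a x <= eps / 8.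
  move=> /dist_lip xy; apply: le_trans rL.
  by rewrite -mulrBl ler_pM2r ?invr_gt0// lerBlDl -natrD ler_nat.
have a_small x y : W' x -> W' y -> (len (x^-1 * y)%g <= r)%N -> c x <> c y ->
    a x <= eps / 8.
  move=> Wx Wy xy /(sep _ _ _ Wx Wy xy)[z Wz zx]; apply: le_trans rL.
  by rewrite ler_pM2r ?invr_gt0// ler_nat (dist_min _ _ _ Wz zx).
exists s, (fun x f => (1 - a x) * mP x f + a x * mC (c x) x f); split.
  by move=> x _; exact: mean_on_convex (a01 x) (meanP x) (meanC x).
move=> x y Wx Wy xy f f1.
have yx : (len (y^-1 * x)%g <= r)%N by rewrite len_sym.
have Ax := a01 x; have axy := a_lip x y xy; have ayx := a_lip y x yx.
have P1 : (1 - a x) * (mP x f - mP y f) <= eps / 4.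
  have /ler_normlP[_ px1] := mean_on_ler1 (meanP x) f1.
  have /ler_normlP[py1 _] := mean_on_ler1 (meanP y) f1.
  have aL z : ~~ (dist z < L)%N -> a z = 1.
    rewrite -leqNgt => Lz; rewrite /a (_ : dist z = L) ?divff ?gt_eqF//.
    by apply/eqP; rewrite eqn_leq dist_le.
  have [xL|/aL ->] := boolP (dist x < L)%N; last by rewrite subrr mul0r ltW.
  (* If y is far from [W], then 1 - a x is at most eps / 8, while the two means differ by at most
     2. *)
  have [yL|/aL ayE] := boolP (dist y < L)%N; last by rewrite ayE in axy; nra.
  have [Wp px] := pP x xL; have [Wq qy] := pP y yL.
  have : mP x f - mP y f <= eps / 4.
    rewrite /mP xL yL; apply: closeW => //.
    have := len_tri (p x) x (p y); have := len_tri x y (p y).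
    by rewrite (len_sym y (p y)); lia.
  by nra.
have P2 : a x * (mC (c x) x f - mC (c y) y f) <= eps / 4.
  have /ler_normlP[_ cx1] := mean_on_ler1 (meanC x) f1.
  have /ler_normlP[cy1 _] := mean_on_ler1 (meanC y) f1.
  have [cxy|cxy] := pselect (c x = c y).
    have [_ /(_ x y cxy erefl xy f f1)] := mCP (c y); rewrite cxy; nra.
  by have := a_small x y Wx Wy xy cxy; nra.
have P3 : (a y - a x) * (mP y f - mC (c y) y f) <= eps / 4.
  have /ler_normlP[py1 py2] := mean_on_ler1 (meanP y) f1.
  have /ler_normlP[cy1 cy2] := mean_on_ler1 (meanC y) f1.
  by nra.
rewrite [leLHS](_ : _ = (1 - a x) * (mP x f - mP y f) +
  a x * (mC (c x) x f - mC (c y) y f) + (a y - a x) * (mP y f - mC (c y) y f));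
  by [ring|lra].
Qed.


End UniformA.

(** * Averaging over ancestors *)

Section Average.
Variables (R : realType) (Gamma : groupType) (len : Gamma -> nat).

(** Along a shift all terms but one on each side pair off, and the two means of a pair come from the
    same member of the family. *)
Lemma average_A (I : Type) (anc : nat -> Gamma -> I) :
  (forall n, uniform_A R len (fun i => [set x | exists2 k, (k <= n)%N & anc k x = i])) ->
  forall r (eps : R), 0 < eps -> exists s (m : Gamma -> (Gamma -> R) -> R),
    (forall x, mean_on [set z | len (x^-1 * z)%g <= s]%N (m x)) /\
    (forall x y, (len (x^-1 * y)%g <= r)%N ->
      [\/ forall k, anc k x = anc k y, forall k, anc k.+1 x = anc k y
        | forall k, anc k x = anc k.+1 y] ->
      forall f, (forall z, `|f z| <= 1) -> m x f - m y f <= eps).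
Proof.
move=> ancA r eps eps0; pose n := Num.truncn (4 / eps).
have n0 : 0 < n.+1%:R :> R by rewrite ltr0n.
have nE : 4 < eps * n.+1%:R by rewrite mulrC -ltr_pdivrMr// truncnS_gt.
have e2 : 0 < eps / 2 by lra.
have [s [M MP]] := ancA n r _ e2.
have meanM k x : (k < n.+1)%N ->
    mean_on [set z | len (x^-1 * z)%g <= s]%N (M (anc k x) x).
  by move=> kn; have [+ _] := MP (anc k x); apply; exists k.
exists s, (fun x f => (\sum_(0 <= k < n.+1) M (anc k x) x f) / n.+1%:R); split.
  by move=> x; apply: mean_on_average => k kn; exact: meanM.
move=> x y xy shift f f1.
have XY k l : (k <= n)%N -> (l <= n)%N -> anc k x = anc l y ->
    M (anc k x) x f - M (anc l y) y f <= eps / 2.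
  move=> kn ln kl; have [_ close] := MP (anc l y).
  by rewrite kl; apply: close => //=; [exists k|exists l].
have X1 k : (k < n.+1)%N -> M (anc k x) x f <= 1.
  by move=> kn; have /ler_normlP[] := mean_on_ler1 (meanM k x kn) f1.
have Y1 k : (k < n.+1)%N -> - M (anc k y) y f <= 1.
  by move=> kn; have /ler_normlP[] := mean_on_ler1 (meanM k y kn) f1.
have sum_le j (F : nat -> R) : (j <= n.+1)%N -> (forall k, (k < j)%N -> F k <= eps / 2) ->
    \sum_(0 <= k < j) F k <= n.+1%:R * (eps / 2).
  move=> jn Fk; apply: (@le_trans _ _ (\sum_(0 <= k < j) (eps / 2))).
    by rewrite !big_nat ler_sum// => k /andP[_ /Fk].
  by rewrite sumr_const_nat subn0 -[leLHS]mulr_natl ler_pM2r// ler_nat.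
suff : \sum_(0 <= k < n.+1) M (anc k x) x f - \sum_(0 <= k < n.+1) M (anc k y) y f
       <= n.+1%:R * (eps / 2) + 2.
  by rewrite -mulrBl ler_pdivrMr//; lra.
case: shift => anc_xy.
- rewrite -sumrB (le_trans (sum_le n.+1 _ _ _))// ?lerDl// => k kn.
  exact: XY.
- rewrite big_nat_recl// [X in _ - X]big_nat_recr//=.
  have := X1 0%N isT; have := Y1 n (ltnSn n).
  have := sum_le n (fun k => M (anc k.+1 x) x f - M (anc k y) y f) (leqnSn n).
  rewrite sumrB => /(_ _)/wrap[k kn|]; first by apply: XY => //; exact: ltnW.
  by lra.
- rewrite big_nat_recr// [X in _ - X]big_nat_recl//=.
  have := X1 n (ltnSn n); have := Y1 0%N isT.
  have := sum_le n (fun k => M (anc k x) x f - M (anc k.+1 y) y f) (leqnSn n).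
  rewrite sumrB => /(_ _)/wrap[k kn|]; first by apply: XY => //; exact: ltnW.
  by lra.
Qed.
End Average.

(** * Regions between two graphs *)

Section Layer.
Variable T : choiceType.
Implicit Types (lo hi : T -> nat) (C : {fset T}).

(** With [lo] zero this is the subgraph of [hi] over [C]. Intersections and differences of subgraphs
    are again layers, so their cardinals become sums over [C]. *)
Definition layer lo hi C : {fset T * nat} :=
  [fset p in [seq (z, n) | z <- enum_fset C, n <- index_iota (lo z) (hi z)]]%fset.

Lemma in_layer lo hi C z n :
  ((z, n) \in layer lo hi C) = (z \in C) && (lo z <= n < hi z)%N.
Proof.
rewrite inE /=; apply/allpairsPdep/andP => [[z' [n' [zC]]]|[zC nz]].
  by rewrite mem_index_iota => nz [-> ->].
by exists z, n; rewrite mem_index_iota.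
Qed.

Lemma card_layer lo hi C : #|` layer lo hi C|%fset = (\sum_(z <- C) (hi z - lo z))%N.
Proof.
rewrite card_fseq undup_id.
  rewrite size_allpairs_dep sumnE big_map; apply: eq_bigr => z _.
  by rewrite size_iota.
apply: allpairs_uniq_dep => //; first by move=> z _; exact: iota_uniq.
by move=> [z n] [z' n'] _ _ /= [-> ->].
Qed.

End Layer.

(** * From means to finite sets, and back *)

Section Rounding.
Variables (R : realType) (T : choiceType).
Implicit Types (m : (T -> R) -> R) (C : {fset T}) (M : nat).

Definition round_mass M m (z : T) : nat := Num.truncn (M%:R * point_mass m z).

Lemma round_mass_itv M m B z : mean_on B m ->
  M%:R * point_mass m z - 1 <= (round_mass M m z)%:R <= M%:R * point_mass m z.
Proof.
move=> mB; have := point_mass_ge0 z mB => p0.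
have := truncnS_gt (M%:R * point_mass m z).
rewrite /round_mass truncn_le mulr_ge0// andbT -natr1 => H.
by rewrite lerBlDr ltW.
Qed.

(** Test against the sign of the difference of the point masses. *)
Lemma mean_on_l1dist C m m' (eps : R) : mean_on [set` C] m -> mean_on [set` C] m' ->
  (forall f, (forall z, `|f z| <= 1) -> m f - m' f <= eps) ->
  \sum_(z <- C) `|point_mass m z - point_mass m' z| <= eps.
Proof.
move=> mC mC' close; pose f z := Num.sg (point_mass m z - point_mass m' z).
suff -> : \sum_(z <- C) `|point_mass m z - point_mass m' z| = m f - m' f.
  by apply: close => z; rewrite /f normr_sg lern1 leq_b1.
rewrite (mean_on_point_mass _ mC) (mean_on_point_mass _ mC') -sumrB.
by apply: eq_bigr => z _; rewrite -mulrBr /f -normrEsg.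
Qed.

(** Rounding down costs at most 1 per point of [C], in total at most M del. The numerator is then at
    most 2 M del, and the denominator at least M - 2 M del, hence at least 3 M / 4. *)
Lemma round_mass_ratio C M m m' (del eps : R) : mean_on [set` C] m -> mean_on [set` C] m' ->
  (forall f, (forall z, `|f z| <= 1) -> m f - m' f <= del) ->
  0 < del -> (#|` C|%fset)%:R <= M%:R * del -> (0 < M)%N -> 8 * del <= eps -> 8 * del <= 1 ->
  let w := round_mass M m in let w' := round_mass M m' in
  0 < (\sum_(z <- C) minn (w z) (w' z))%:R :> R /\
  (\sum_(z <- C) (w z - w' z) + \sum_(z <- C) (w' z - w z))%:R /
    (\sum_(z <- C) minn (w z) (w' z))%:R < eps.
Proof.
move=> mC mC' close d0 CM M0 deps d1 w w'.
have M0R : 0 < M%:R :> R by rewrite ltr0n.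
pose p z := point_mass m z; pose p' z := point_mass m' z.
have l1 : \sum_(z <- C) `|p z - p' z| <= del by exact: mean_on_l1dist.
have p1 : \sum_(z <- C) p z = 1.
  have [_ _ <-] := mC; rewrite (mean_on_point_mass _ mC).
  by apply: eq_bigr => z _; rewrite mul1r.
have sum1 : \sum_(z <- C) 1 = #|` C|%fset%:R :> R.
  by rewrite card_fset_sum1 natr_sum.
have wI z := round_mass_itv M z mC; have wI' z := round_mass_itv M z mC'.
have natB (i j : nat) : (i - j)%:R + (j - i)%:R = `|i%:R - j%:R| :> R.
  wlog ij : i j / (i <= j)%N => [hw|].
    by case/orP: (leq_total i j) => /hw//; rewrite distrC addrC.
  by rewrite (eqP ij) add0r natrB// ler0_norm ?opprB// subr_le0 ler_nat.
have DE : (\sum_(z <- C) (w z - w' z) + \sum_(z <- C) (w' z - w z))%:R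
    <= 2 * (M%:R * del) :> R.
  rewrite natrD !natr_sum -big_split/=.
  apply: (@le_trans _ _ (\sum_(z <- C) (M%:R * `|p z - p' z| + 1))).
    apply: ler_sum => z _; rewrite natB.
    have /andP[] := wI z; have /andP[] := wI' z; rewrite -/(p z) -/(p' z) -/(w z) -/(w' z).
    by case: (lerP (p' z) (p z)) => h; rewrite ler_norml; nra.
  by rewrite big_split/= -mulr_sumr sum1; nra.
have cE : M%:R - 2 * (M%:R * del) <= (\sum_(z <- C) minn (w z) (w' z))%:R :> R.
  apply: (@le_trans _ _ (\sum_(z <- C) (M%:R * p z - M%:R * `|p z - p' z| - 1))).
    by rewrite !sumrB -!mulr_sumr sum1 p1; nra.
  rewrite natr_sum; apply: ler_sum => z _.
  have /andP[] := wI z; have /andP[] := wI' z; rewrite -/(p z) -/(p' z) -/(w z) -/(w' z).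
  rewrite /minn; case: ifP => _;
  by case: (lerP (p' z) (p z)) => h; nra.
have c0 : 0 < (\sum_(z <- C) minn (w z) (w' z))%:R :> R by nra.
split=> //; rewrite ltr_pdivrMr//; apply: le_lt_trans DE _.
have Me : M%:R * (8 * del) <= M%:R * eps by rewrite ler_pM2l.
have Me0 : 0 < M%:R * eps by rewrite mulr_gt0//; lra.
have M1 : M%:R * (8 * del) <= M%:R * 1 by rewrite ler_pM2l.
have ce : eps * (M%:R * (3 / 4)) <= eps * (\sum_(z <- C) minn (w z) (w' z))%:R.
  by rewrite ler_pM2l; lra.
by lra.
Qed.

End Rounding.

(** * The left-invariant metric of a proper length *)

Section LengthMetric.
Variables (R : realType) (Gamma : groupType) (len : Gamma -> nat).
Hypothesis len_proper : proper_length len.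

Definition length_dist (x y : Gamma) : R := (len (x^-1 * y)%g)%:R.

Lemma length_dist_is_metric : is_metric length_dist.
Proof.
split; rewrite /length_dist.
- by move=> x; rewrite mulVg (proj2 (len_eq0 len_proper _)).
- move=> x y /eqP; rewrite pnatr_eq0 => /eqP/(len_eq0 len_proper) xy.
  by apply: (mulgI x^-1%g); rewrite xy mulVg.
- by move=> x y; rewrite -(lenV len_proper) invgM invgK.
- move=> y x z; rewrite -natrD ler_nat.
  by apply: leq_trans (lenM len_proper _ _); rewrite mulgA mulgK.
Qed.

Lemma length_dist_invariant : left_invariant length_dist.
Proof. by move=> h g g'; rewrite /length_dist invgM -mulgA mulKg. Qed.

Definition length_ball (s : nat) (x : Gamma) : {fset Gamma} :=
  [fset (x * z)%g | z in fset_set [set z | len z <= s]%N]%fset.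

Lemma in_length_ball s x z : (z \in length_ball s x) = (len (x^-1 * z)%g <= s)%N.
Proof.
apply/imfsetP/idP => /= [[y + ->]|xz].
  by rewrite in_fset_set ?mulKg ?inE//; exact: (len_finite len_proper).
exists (x^-1 * z)%g; last by rewrite mulVKg.
by rewrite in_fset_set ?inE//; exact: (len_finite len_proper).
Qed.

Lemma card_length_ball s x :
  (#|` length_ball s x|%fset <= #|` fset_set [set z | len z <= s]%N|%fset)%N.
Proof. exact: leq_imfset_card. Qed.

Lemma length_dist_bounded_geometry :
  bounded_geometry (metric_by length_dist_is_metric).
Proof.
move=> r r0; exists (#|` fset_set [set z | len z <= Num.truncn r]%N|%fset).+1 => x.
have sub : (ball x r : set (metric_by length_dist_is_metric)) `<=`
    [set` length_ball (Num.truncn r) x].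
  move=> y; rewrite ballEmdist/= mdist_metric_by in_length_ball => /ltW.
  by rewrite truncn_ge_nat// ltW.
have fin : finite_set (ball x r : set (metric_by length_dist_is_metric)).
  exact: sub_finite_set sub (finite_fset _).
split=> //; rewrite ltnS; apply: leq_trans (card_length_ball _ x).
apply: fsubset_leq_card; apply/fsubsetP => y.
by rewrite in_fset_set// inE => /sub.
Qed.

(** The finite set at x is the subgraph of the point masses of [m x], scaled by a large integer [M]
    and rounded down. *)
Lemma group_property_A_length : set_A R len setT -> group_property_A R Gamma.
Proof.
move=> TA; exists length_dist, length_dist_is_metric; split.
- exact: length_dist_invariant.
- exact: length_dist_bounded_geometry.
move=> r eps r0 eps0; pose del := Num.min eps 1 / 8.
have del0 : 0 < del by rewrite divr_gt0// lt_min eps0/=.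
have [s [m [mean close]]] := TA (Num.truncn r) del del0.
pose N := #|` fset_set [set z | len z <= s]%N|%fset.
(* Two balls of radius [s] have at most N + N points, and rounding may cost at most [M * del]. *)
pose M := (Num.truncn ((N + N)%:R / del)).+1.
have NM : (N + N)%:R <= M%:R * del.
  by rewrite -ler_pdivrMr//; apply/ltW/truncnS_gt.
pose w x := round_mass M (m x).
pose A x := layer (fun=> 0%N) (w x) (length_ball s x).
have meanC x (C : {fset Gamma}) : (length_ball s x `<=` C)%fset -> mean_on [set` C] (m x).
  move=> xC; apply: sub_mean_on (mean x I) => z /= xz.
  by apply: (fsubsetP xC); rewrite in_length_ball.
have w0 x z : z \notin length_ball s x -> w x z = 0%N.
  move=> zx; rewrite /w /round_mass /point_mass (mean_on_eq (g := fun=> 0) (mean x I)).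
    by rewrite (mean_on0 (mean x I)) mulr0 truncn0.
  move=> y /=; rewrite -in_length_ball => yx; case: eqP => // yz.
  by rewrite -yz yx in zx.
have AE x (C : {fset Gamma}) z n : (length_ball s x `<=` C)%fset ->
    ((z, n) \in A x) = (z \in C) && (n < w x z)%N.
  move=> xC; rewrite in_layer/=.
  have [/(fsubsetP xC) -> //|/w0->] := boolP (z \in length_ball s x).
  by rewrite !andbF.
have main x y : length_dist x y <= r -> (A x `&` A y != fset0)%fset /\
    #|` (A x `\` A y) `|` (A y `\` A x)|%fset%:R / #|` A x `&` A y|%fset%:R < eps.
  move=> xy; pose C := (length_ball s x `|` length_ball s y)%fset.
  have xC : (length_ball s x `<=` C)%fset by exact: fsubsetUl.
  have yC : (length_ball s y `<=` C)%fset by exact: fsubsetUr.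
  have IE : (A x `&` A y)%fset = layer (fun=> 0%N) (fun z => minn (w x z) (w y z)) C.
    apply/fsetP => -[z n]; rewrite inE (AE _ _ _ _ xC) (AE _ _ _ _ yC) in_layer/= leq_min.
    by case: (z \in C).
  have DE x' y' : (length_ball s x' `<=` C)%fset -> (length_ball s y' `<=` C)%fset ->
      (A x' `\` A y')%fset = layer (w y') (w x') C.
    move=> xC' yC'; apply/fsetP => -[z n].
    rewrite inE (AE _ _ _ _ xC') (AE _ _ _ _ yC') in_layer/=.
    by case: (z \in C); rewrite //= -leqNgt.
  have disj : ((A x `\` A y) `&` (A y `\` A x) = fset0)%fset.
    apply/fsetP => p; rewrite in_fset0 in_fsetI !in_fsetD.
    by case: (p \in A x); case: (p \in A y).
  have [||||||||c0 ratio] := @round_mass_ratio _ _ C M (m x) (m y) del eps.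
  - exact: meanC.
  - exact: meanC.
  - move=> f f1; apply: close => //; rewrite truncn_ge_nat//.
    exact: ltW.
  - by [].
  - apply: le_trans NM; rewrite ler_nat cardfsU (leq_trans (leq_subr _ _))//.
    by rewrite leq_add// card_length_ball.
  - by [].
  - by rewrite /del mulrC divfK// ge_min lexx.
  - by rewrite /del mulrC divfK// ge_min lexx orbT.
  have cI : #|` A x `&` A y|%fset = (\sum_(z <- C) minn (w x z) (w y z))%N.
    by rewrite IE card_layer; apply: eq_bigr => z _; rewrite subn0.
  split; first by rewrite -cardfs_gt0 cI -(ltr0n R).
  by rewrite cI cardfsU disj cardfs0 subn0 !DE// !card_layer.
exists A; split=> //.
(* Non-emptiness of [A x] is the case x = y of the non-empty intersections. *)
- move=> x; have [|/fset0Pn[p]] := main x x.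
    by rewrite (is_metric_xx length_dist_is_metric) ltW.
  by rewrite inE => /andP[px _] _; apply/fset0Pn; exists p.
- exists s%:R => x y n; rewrite in_layer => /andP[+ _].
  by rewrite in_length_ball mdist_metric_by ler_nat.
Qed.

End LengthMetric.

Section UniformMean.
Variables (R : realType) (T : choiceType).

Definition uniform_mean (A : {fset T * nat}) (f : T -> R) : R :=
  (\sum_(p <- A) f p.1) / #|` A|%fset%:R.

Lemma uniform_mean_on (B : set T) (A : {fset T * nat}) : (A != fset0)%fset ->
  (forall p, p \in A -> B p.1) -> mean_on B (uniform_mean A).
Proof.
rewrite -cardfs_gt0 => A0 AB; split.
- by move=> a f g; rewrite /uniform_mean mulrA -mulrDl big_split/= mulr_sumr.
- move=> f f0; rewrite divr_ge0// big_seq sumr_ge0// => p pA.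
  exact/f0/AB.
- have sum1 : \sum_(p <- A) 1 = #|` A|%fset%:R :> R by rewrite card_fset_sum1 natr_sum.
  by rewrite /uniform_mean sum1 divff// pnatr_eq0 -lt0n.
Qed.

(** The terms outside the intersection and the change of the normalising constant cost at most [eps]
    each. *)
Lemma uniform_mean_close (A A' : {fset T * nat}) (eps : R) (f : T -> R) :
  (A `&` A' != fset0)%fset ->
  #|` (A `\` A') `|` (A' `\` A)|%fset%:R / #|` A `&` A'|%fset%:R < eps ->
  (forall z, `|f z| <= 1) -> uniform_mean A f - uniform_mean A' f <= 2 * eps.
Proof.
rewrite -cardfs_gt0 -(ltr0n R) => I0; rewrite ltr_pdivrMr// => ratio f1.
have disj : ((A `\` A') `&` (A' `\` A) = fset0)%fset.
  apply/fsetP => p; rewrite in_fset0 in_fsetI !in_fsetD.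
  by case: (p \in A); case: (p \in A').
move: ratio; rewrite cardfsU disj cardfs0 subn0 natrD => ratio.
pose S (B : {fset T * nat}) : R := \sum_(p <- B) f p.1.
have S_le B : - (#|` B|%fset%:R) <= S B <= #|` B|%fset%:R.
  rewrite -ler_norml card_fset_sum1 natr_sum (le_trans (ler_norm_sum _ _ _))//.
  by apply: ler_sum => p _.
have SID B B' : S B = S (B `&` B')%fset + S (B `\` B')%fset.
  rewrite /S (big_fsetID _ (mem B'))/=; congr (_ + _).
    by apply: eq_fbigl => p; rewrite !inE.
  by apply: eq_fbigl => p; rewrite !inE andbC.
have cID (B B' : {fset T * nat}) :
    #|` B|%fset%:R = #|` B `&` B'|%fset%:R + #|` B `\` B'|%fset%:R :> R.
  by rewrite -natrD cardfsID.
have a0 : 0 <= #|` A `\` A'|%fset%:R :> R by [].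
have a0' : 0 <= #|` A' `\` A|%fset%:R :> R by [].
rewrite /uniform_mean -/(S A) -/(S A') (SID A A') (SID A' A) (cID A A') (cID A' A).
rewrite [(A' `&` A)%fset]fsetIC.
have /andP[i1 i2] := S_le (A `&` A')%fset.
have /andP[s1 s2] := S_le (A `\` A')%fset.
have /andP[t1 t2] := S_le (A' `\` A)%fset.
move: I0 ratio a0 a0' i1 i2 s1 s2 t1 t2.
move: (S (A `&` A')%fset) (S (A `\` A')%fset) (S (A' `\` A)%fset).
move: (#|` A `&` A'|%fset%:R : R) (#|` A `\` A'|%fset%:R : R) (#|` A' `\` A|%fset%:R : R).
(* i, a, b are the cardinals of the intersection and of the two differences; x, y, z are the sums of
   f over these sets. *)
move=> i a b x y z i0 ratio a0 b0 i1 i2 y1 y2 z1 z2.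
have ia : 0 < i + a by lra.
have ib : 0 < i + b by lra.
have -> : (x + y) / (i + a) - (x + z) / (i + b) =
   (x * (b - a) + y * (i + b) - z * (i + a)) / ((i + a) * (i + b)).
  by field; rewrite !gt_eqF.
rewrite ler_pdivrMr ?mulr_gt0//.
have h1 : x * (b - a) <= i * (a + b) by nra.
have h2 : y * (i + b) <= a * (i + b) by nra.
have h3 : - z * (i + a) <= b * (i + a) by nra.
have h4 : i * (a + b) <= i * (eps * i) by nra.
have h5 : a * b <= eps * i * (a + b) by nra.
have eps0 : 0 < eps by nra.
have h6 : 0 <= eps * (a * b) by rewrite !mulr_ge0// ltW.
by nra.
Qed.
End UniformMean.

Lemma finite_set_natmax (T : choiceType) (A : set T) (F : T -> nat) :
  finite_set A -> exists N, forall x, A x -> (F x <= N)%N.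
Proof.
move=> fA; exists (\max_(x <- fset_set A) F x)%N => x Ax.
by apply: leq_bigmax_seq => //; rewrite in_fset_set// inE.
Qed.

(** * Transport of property A to an embedded subgroup *)

Section Embedding.
Variables (R : realType) (G Gamma : groupType) (len : Gamma -> nat).
Variables (iota : G -> Gamma) (d : G -> G -> R) (dm : is_metric d).
Hypothesis len_finite : forall n, finite_set [set x | len x <= n]%N.
Hypothesis iotaM : {morph iota : x y / (x * y)%g}.
Hypothesis iota_inj : injective iota.
Hypothesis d_inv : left_invariant d.
Hypothesis len_iota : forall g, (len (iota g) <= (Num.truncn (d 1%g g)).+1)%N.

(** [iota] is a coarse embedding: [len_iota] bounds lengths by [d], and finiteness of balls in
    [Gamma] bounds [d] by lengths. So uniform means push forward along [iota]. *)
Lemma set_A_embedding : property_A (metric_by dm) -> set_A R len (range iota).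
Proof.
have iota1 : iota 1%g = 1%g by apply: (mulgI (iota 1%g)); rewrite -iotaM !mulg1.
have iotaVM g g' : ((iota g)^-1 * iota g')%g = iota (g^-1 * g')%g.
  by apply: (mulgI (iota g)); rewrite mulVKg -iotaM mulVKg.
have dE g g' : d g g' = d 1%g (g^-1 * g')%g by rewrite -[RHS](d_inv g) mulg1 mulVKg.
move=> GA r eps eps0.
(* By injectivity only finitely many g satisfy [len (iota g) <= r]. Truncation loses less than 1,
   whence the radius N + 1 below. *)
have [N NP] : exists N, forall g, (len (iota g) <= r)%N -> (Num.truncn (d 1%g g) <= N)%N.
  apply: finite_set_natmax; apply: (@finite_preimage _ _ [set x | len x <= r]%N) => //.
  by move=> g g' _ _; exact: iota_inj.
have e2 : 0 < eps / 2 by lra.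
have [A [A0 Aclose [s As]]] := GA N.+1%:R _ (ltr0Sn _ _) e2.
(* A section of [iota] over its range, with value 1 elsewhere. *)
have /choice[gi giP] : forall x, exists g, range iota x -> iota g = x.
  move=> x; have [[g _ gx]|nx] := pselect (range iota x); first by exists g.
  by exists 1%g.
exists (Num.truncn s).+1, (fun x f => uniform_mean (A (gi x)) (f \o iota)); split.
  move=> x /giP gx.
  apply: (@mean_on_image _ _ _ [set g | len (x^-1 * iota g)%g <= (Num.truncn s).+1]%N) => //.
  apply: uniform_mean_on => // -[g n] /As; rewrite mdist_metric_by dE => gs /=.
  by rewrite -{1}gx iotaVM (leq_trans (len_iota _))// ltnS le_truncn.
move=> x y /giP gx /giP gy xy f f1.
have dxy : d (gi x) (gi y) <= N.+1%:R.
  rewrite dE ltW// -truncn_le_nat; apply: NP.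
  by rewrite -iotaVM gx gy.
have [I0 ratio] := Aclose (gi x) (gi y) dxy.
have := uniform_mean_close I0 ratio (f := f \o iota) (fun z => f1 (iota z)).
by rewrite mulrC divfK.
Qed.
End Embedding.

Lemma subgroup_isom_associated (G : groupType) (H K : groupClosed G) (alpha : G -> G) :
  subgroup_isom H K alpha -> exists beta, associated H K alpha beta.
Proof.
move=> [aM [aHK a_inj a_surj]].
(* The inverse of alpha on K, with value 1 elsewhere. *)
have /choice[beta betaP] : forall k, exists h, k \in K -> h \in H /\ alpha h = k.
  move=> k; case: (boolP (k \in K)) => [/a_surj[h /= hH <-]|_]; last by exists 1%g.
  by exists h.
have bH k : k \in K -> beta k \in H by case/betaP.
have aK h : h \in H -> alpha h \in K by move=> /aHK.
exists beta; split=> //.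
- move=> h hH; have [bh abh] := betaP _ (aK h hH).
  by apply: a_inj => //; rewrite inE.
- by move=> k /betaP[].
Qed.

(** * Property A of the extension *)

Section Extension.
Variables (R : realType) (G : groupType) (H K : groupClosed G) (alpha beta : G -> G).
Hypothesis assoc : associated H K alpha beta.
Variable w : G -> nat.
Hypothesis wV : forall g, w g^-1%g = w g.
Hypothesis w_fin : forall n, finite_set [set g | w g <= n]%N.

Notation Gamma := (hnn_extension H alpha).
Notation pi := (\pi_Gamma)%qT.
Notation len := (hnn_length (H := H) (alpha := alpha) w).
Notation stack := (stack K beta).
Notation branch := (branch H alpha).

Lemma hnn_length_proper : proper_length len.
Proof.
have inv_le x : (len x^-1%g <= len x)%N.
  have [u <- <-] := hnn_lengthP w x.
  rewrite [X in len X](_ : _ = pi (hnn_word_inv u)).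
    by rewrite -(word_weight_inv wV) hnn_length_le.
  apply: (mulgI (pi u)); rewrite mulgV [RHS]hnn_mul_pi.
  by apply/esym/hnn_piP; exact: hnn_word_mulV.
split.
- move=> x; split=> [x0|->]; last first.
    by apply/eqP; rewrite -leqn0; exact: (hnn_length_le H alpha w [::]).
  have [u ux uw] := hnn_lengthP w x; rewrite -uw in x0; rewrite -ux.
  by have := size_word_weight w u; rewrite x0 leqn0 => /nilP->.
- by move=> x; apply/eqP; rewrite eqn_leq inv_le -{1}(invgK x) inv_le.
- move=> x y; have [u ux <-] := hnn_lengthP w x; have [v vy <-] := hnn_lengthP w y.
  rewrite -word_weight_cat -ux -vy [X in len X](_ : _ = pi (u ++ v)).
    exact: hnn_length_le.
  exact: hnn_mul_pi.
- move=> n; apply: (@sub_finite_set _ _ (pi @` [set u | word_weight w u <= n]%N)).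
    by move=> x /= xn; have [u ux uw] := hnn_lengthP w x; exists u => //=; rewrite uw.
  by apply: finite_image; exact: finite_words.
Qed.

Hypothesis base_A : set_A R len (range (hnn_base H alpha)).

Lemma set_A_size_stack n : set_A R len [set x | size (stack x) <= n]%N.
Proof.
(* Elements with stack s lie in the translate of G by [branch s]. *)
have fibre_A : uniform_A R len (fun s => [set x | stack x = s]).
  apply: (uniform_A_translate (g := branch) base_A) => s x /= <-.
  exists (normal_form K beta x).2 => //.
  by rewrite -[X in (_ * X)%g](normal_formK assoc x) mulKg.
elim: n => [|n IH].
  move=> r eps eps0; have [s [m mP]] := fibre_A r eps eps0.
  exists s, (m [::]); rewrite (_ : [set x | _] = [set x | stack x = [::]])//.
  by apply/seteqP; split=> x /=; rewrite leqn0 => /nilP.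
apply: (set_A_union hnn_length_proper IH fibre_A) => r x y /= xn yn xy nxy.
have [u ue ul] := hnn_lengthP w (x^-1 * y)%g.
have yE : y = (x * pi u)%g by rewrite ue mulVKg.
have [|||v [v' [uE vn]]] := @stack_separation _ H K alpha beta assoc n x u => //.
- by rewrite -yE.
- by rewrite -yE => /esym.
(* A prefix of a shortest word from x to y reaches depth n, and its weight is at most that of the
   whole word. *)
exists (x * pi v)%g => //.
rewrite -(lenV hnn_length_proper) invgM invgK mulKg.
apply: leq_trans (hnn_length_le _ _ _ _) (leq_trans _ xy).
by rewrite -ul uE word_weight_cat leq_addr.
Qed.

Lemma set_A_hnn_extension : set_A R len setT.
Proof.
move=> r eps eps0.
(* A word of weight at most r has at most r letters; it is followed letter by letter, at a cost of
   at most [eps'] each. *)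
pose eps' := eps / r.+1%:R.
have eps'0 : 0 < eps' by rewrite divr_gt0.
(* By [stack_split], the elements having s among their ancestors 0 to n are translates by [branch s]
   of elements of depth at most n. *)
have anc_A n : uniform_A R len
    (fun s => [set x | exists2 k, (k <= n)%N & drop k (stack x) = s]).
  apply: (uniform_A_translate (g := branch) (set_A_size_stack n)).
  move=> s x [k kn <-]; have [y [xE yk]] := stack_split assoc x k.
  by rewrite /= {2}xE mulKg (leq_trans yk).
have [s [m [mean close]]] := average_A anc_A r eps'0.
exists s, m; split=> // x y _ _ xy f f1.
suff word u : (word_weight w u <= r)%N ->
    m x f - m (x * pi u)%g f <= (size u)%:R * eps'.
  have [u ue ul] := hnn_lengthP w (x^-1 * y)%g.
  have ur : (word_weight w u <= r)%N by rewrite ul.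
  have := word u ur; rewrite ue mulVKg => /le_trans; apply.
  rewrite /eps' mulrA ler_pdivrMr// mulrC ler_pM2l// ler_nat.
  by have := size_word_weight w u; lia.
elim: u x {xy} => [|a u IH] x au.
  by rewrite [(_ * _)%g](mulg1 x) subrr mul0r.
have -> : (x * pi (a :: u) = x * pi [:: a] * pi u)%g.
  by rewrite -mulgA -(pi_cat H alpha [:: a]).
have /IH IHu : (word_weight w u <= r)%N by move: au; rewrite /word_weight /=; lia.
have step : m x f - m (x * pi [:: a])%g f <= eps'.
  apply: close => //.
    rewrite mulKg (leq_trans (hnn_length_le _ _ _ _))// (leq_trans _ au)//.
    by rewrite /word_weight /=; lia.
  (* Keeping, popping and pushing are the three shifts of ancestors. As [drop] fixes the empty
     stack, the base vertex is its own ancestor. *)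
  case: (stack_letter assoc x a) => [->|->|[p ->]]; first by constructor 1.
    by constructor 2 => k; case: (stack x).
  by constructor 3.
have := IHu (x * pi [:: a])%g; rewrite /= -natr1; lra.
Qed.

End Extension.

Theorem corollary2p3p12 (R : realType) (G : groupType) (H K : groupClosed G)
    (alpha : G -> G) :
  countable [set: G]%classic ->
  group_property_A R G ->
  subgroup_isom H K alpha ->
  group_property_A R (hnn_extension H alpha).
Proof.
move=> _ [d [dm [d_inv d_geom GA]]] /subgroup_isom_associated[beta assoc].
pose w g := Num.truncn (d 1%g g).
have wV g : w g^-1%g = w g.
  by rewrite /w (is_metric_sym dm) -(d_inv g) mulgV mulg1.
have w_fin n : finite_set [set g | w g <= n]%N.
  (* [w g <= n] means [d 1 g < n + 1], hence the ball of radius n + 1. *)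
  have [N /(_ 1%g)[+ _]] := d_geom n.+1%:R (ltr0Sn _ _).
  apply: sub_finite_set => g /=; rewrite ballEmdist/= mdist_metric_by.
  by rewrite truncn_le_nat.
have len_proper := hnn_length_proper H alpha wV w_fin.
apply: (group_property_A_length len_proper).
apply: (set_A_hnn_extension assoc wV w_fin).
apply: (set_A_embedding (dm := dm)) => //.
- exact: len_finite len_proper.
- exact: hnn_baseM.
- exact: hnn_base_inj assoc.
- by move=> g; exact: hnn_length_base.
Qed.
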